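(* There is a positive integer $M$ such that for every integer $m\ge M$, the matrices $\beta_4(\sigma_3\sigma_1^{-1})^m$ and $\beta_4(\sigma_2\sigma_3\sigma_1^{-1}\sigma_2^{-1})^m$ generate a free group of rank $2$ (as a subgroup of $GL_3(\mathbb{Z}[t,t^{-1}])$).
   Context: $\sigma_1,\sigma_2,\sigma_3$ are the standard generators of the braid group $B_4$ on $4$ strings, and $\beta_4:B_4\to GL_3(\mathbb{Z}[t,t^{-1}])$ is the reduced Burau representation, given by $$\beta_4(\sigma_1)=\begin{pmatrix}-t&1&0\\0&1&0\\0&0&1\end{pmatrix},\quad \beta_4(\sigma_2)=\begin{pmatrix}1&0&0\\t&-t&1\\0&0&1\end{pmatrix},\quad \beta_4(\sigma_3)=\begin{pmatrix}1&0&0\\0&1&0\\0&t&-t\end{pmatrix}.$$ *)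

(* Defs.v *)
From HB Require Import structures.
From mathcomp Require Import all_boot all_order all_algebra.
From mathcomp Require Import generic_quotient fraction.
From mathcomp Require Import ring.
From mathcomp Require Import boolp classical_sets functions.

Set Implicit Arguments.
Unset Strict Implicit.
Unset Printing Implicit Defensive.

Import GRing.Theory.

Section Presentation.
Local Open Scope group_scope.

(** The letter [(s, false)] stands for [s] and [(s, true)] for [s^-1]. *)
Definition word (S : Type) : Type := seq (S * bool).

Definition eval_letter (S : Type) (G : groupType) (f : S -> G) (l : S * bool) : G :=
  if l.2 then (f l.1)^-1 else f l.1.

Definition eval_word (S : Type) (G : groupType) (f : S -> G) (w : word S) : G :=
  \prod_(l <- w) eval_letter f l.

Variable S : choiceType.
Variable R : word S -> word S -> Prop.

(** The congruence on words whose classes are the elements of the group with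
    generators [S] and a relation [u = v] for every [R u v]. *)
Inductive pres_eq : word S -> word S -> Prop :=
| pres_refl u : pres_eq u u
| pres_sym u v : pres_eq u v -> pres_eq v u
| pres_trans v u w : pres_eq u v -> pres_eq v w -> pres_eq u w
| pres_cat u u' v v' :
    pres_eq u u' -> pres_eq v v' -> pres_eq (u ++ v) (u' ++ v')
| pres_cancel s b : pres_eq [:: (s, b); (s, ~~ b)] [::]
| pres_rel u v : R u v -> pres_eq u v.

Definition pres_eqb : rel (word S) := fun u v => `[< pres_eq u v >].

Fact pres_eqb_refl : reflexive pres_eqb.
Proof. by move=> u; apply/asboolP/pres_refl. Qed.

Fact pres_eqb_sym : symmetric pres_eqb.
Proof. by move=> u v; apply/asboolP/asboolP; apply: pres_sym. Qed.

Fact pres_eqb_trans : transitive pres_eqb.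
Proof.
by move=> v u w /asboolP uv /asboolP vw; apply/asboolP/(pres_trans uv vw).
Qed.

Canonical pres_equiv :=
  EquivRel pres_eqb pres_eqb_refl pres_eqb_sym pres_eqb_trans.

Local Open Scope quotient_scope.

Definition presented : Type := {eq_quot pres_eqb}.
HB.instance Definition _ := Choice.on presented.
HB.instance Definition _ : EqQuotient _ pres_eqb presented :=
  EqQuotient.on presented.

Definition pres_class (w : word S) : presented := \pi w.

Lemma pres_classP u v : pres_class u = pres_class v <-> pres_eq u v.
Proof.
split=> [/eqP|uv]; first by rewrite eqmodE => /asboolP.
by apply/eqP; rewrite eqmodE; apply/asboolP.
Qed.

Lemma pres_repr u : pres_eq (repr (pres_class u)) u.
Proof. by apply/pres_classP; rewrite /pres_class reprK. Qed.

Definition inv_word (w : word S) : word S := rev [seq (l.1, ~~ l.2) | l <- w].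

Definition pres_one : presented := pres_class [::].
Definition pres_mul (x y : presented) : presented := pres_class (repr x ++ repr y).
Definition pres_inv (x : presented) : presented := pres_class (inv_word (repr x)).

Lemma pres_cancelr w : pres_eq (w ++ inv_word w) [::].
Proof.
elim: w => [|[s b] w IHw]; first exact: pres_refl.
rewrite /inv_word /= rev_cons -cats1 -/(inv_word w).
rewrite -cat1s [X in _ ++ X]catA catA.
apply: (pres_trans (v := [:: (s, b)] ++ [:: (s, ~~ b)])); last exact: pres_cancel.
apply: pres_cat; last exact: pres_refl.
by apply: (@pres_cat _ [:: (s, b)] _ [::]); first exact: pres_refl.
Qed.

Lemma inv_wordK : involutive inv_word.
Proof.
move=> w; rewrite /inv_word map_rev revK -map_comp map_id_in //.
by move=> [s b] _ /=; rewrite negbK.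
Qed.

Lemma pres_cancell w : pres_eq (inv_word w ++ w) [::].
Proof. by rewrite -{2}[w]inv_wordK; exact: pres_cancelr. Qed.

Fact pres_mulA : associative pres_mul.
Proof.
move=> x y z; apply/pres_classP.
apply: (pres_trans (v := repr x ++ repr y ++ repr z)).
  by apply: pres_cat; [exact: pres_refl|exact: pres_repr].
rewrite catA; apply: pres_cat; last exact: pres_refl.
exact/pres_sym/pres_repr.
Qed.

Fact pres_mul1g : left_id pres_one pres_mul.
Proof.
move=> x; rewrite -[RHS]reprK; apply/pres_classP.
by apply: (@pres_cat _ [::]); [exact: pres_repr|exact: pres_refl].
Qed.

Fact pres_mulg1 : right_id pres_one pres_mul.
Proof.
move=> x; rewrite -[RHS]reprK; apply/pres_classP; rewrite -[X in pres_eq _ X]cats0.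
by apply: pres_cat; [exact: pres_refl|exact: pres_repr].
Qed.

Fact pres_mulVg : left_inverse pres_one pres_inv pres_mul.
Proof.
move=> x; apply/pres_classP; apply: pres_trans (pres_cancell (repr x)).
by apply: pres_cat; [exact: pres_repr|exact: pres_refl].
Qed.

Fact pres_mulgV : right_inverse pres_one pres_inv pres_mul.
Proof.
move=> x; apply/pres_classP; apply: pres_trans (pres_cancelr (repr x)).
by apply: pres_cat; [exact: pres_refl|exact: pres_repr].
Qed.

HB.instance Definition _ := isGroup.Build presented
  pres_mulA pres_mul1g pres_mulg1 pres_mulVg pres_mulgV.

Definition pres_gen (s : S) : presented := pres_class [:: (s, false)].

Section Lift.
Variables (G : groupType) (f : S -> G).
Hypothesis fR : forall u v, R u v -> eval_word f u = eval_word f v.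

Lemma eval_word_eq u v : pres_eq u v -> eval_word f u = eval_word f v.
Proof.
elim=> //.
- by move=> {}v w x _ -> _ ->.
- by move=> a a' b b' _ ea _ eb; rewrite /eval_word !big_cat /= -!/(eval_word f _) ea eb.
- move=> s [] /=; rewrite /eval_word !big_cons !big_nil /eval_letter /= mulg1.
    exact: mulVg.
  exact: mulgV.
Qed.

(** The homomorphism induced by a map on generators satisfying the relations;
    the proof [fR] is a (phantom) argument so that the morphism instance below
    can be inferred. *)
Definition pres_lift of (forall u v, R u v -> eval_word f u = eval_word f v) :
  presented -> G := fun x => eval_word f (repr x).

Fact pres_lift_morphism : monoid.monoid_morphism (pres_lift fR).
Proof.
split=> [|x y]; rewrite /pres_lift (eval_word_eq (pres_repr _)) /eval_word.
  by rewrite big_nil.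
by rewrite big_cat.
Qed.

HB.instance Definition _ :=
  isUMagmaMorphism.Build presented G (pres_lift fR) pres_lift_morphism.

Lemma pres_liftE s : pres_lift fR (pres_gen s) = f s.
Proof.
by rewrite /pres_lift (eval_word_eq (pres_repr _)) /eval_word big_seq1.
Qed.

End Lift.
End Presentation.

Section FreeSubgroup.
Local Open Scope group_scope.
Local Open Scope classical_set_scope.

Definition free_group (n : nat) : groupType :=
  presented (fun _ _ : word 'I_n => False).

Definition subgroup_gen (G : groupType) (A : set G) : set G :=
  smallest (fun H : set G => group_closed (mem H)) A.

(** [f] corestricts to an isomorphism from the free group of rank [n] to [H]. *)
Definition free_of_rank (G : groupType) (n : nat) (H : set G) : Prop :=
  exists f : UMagmaMorphism.type (free_group n) G,
    injective f /\ range f = H.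

End FreeSubgroup.

Section Braid.
Local Open Scope group_scope.

(** Artin's presentation; the generator with index [i : 'I_n.-1] is the one
    usually written [sigma_(i+1)]. *)
Inductive braid_rel (n : nat) : word 'I_n.-1 -> word 'I_n.-1 -> Prop :=
| braid_adj (i j : 'I_n.-1) : j = i.+1 :> nat ->
    braid_rel [:: (i, false); (j, false); (i, false)]
              [:: (j, false); (i, false); (j, false)]
| braid_far (i j : 'I_n.-1) : (i.+1 < j)%N ->
    braid_rel [:: (i, false); (j, false)] [:: (j, false); (i, false)].

Definition braid_group (n : nat) : groupType := presented (@braid_rel n).

Definition sigma1 : braid_group 4 := pres_gen _ (@Ordinal 3 0 isT).
Definition sigma2 : braid_group 4 := pres_gen _ (@Ordinal 3 1 isT).
Definition sigma3 : braid_group 4 := pres_gen _ (@Ordinal 3 2 isT).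

End Braid.

Section Laurent.
Local Open Scope ring_scope.

Local Notation K := {fraction {poly int}}.
Local Notation "p %:F" := (FracField.tofrac p).

Fact sub_frac (F : fieldType) (p q x y : F) : x != 0 -> y != 0 ->
  p / x - q / y = (p * y - q * x) / (x * y).
Proof. by move=> x0 y0; field; rewrite x0 y0. Qed.

Fact mul_frac (F : fieldType) (p q x y : F) : (p / x) * (q / y) = (p * q) / (x * y).
Proof. by rewrite invfM mulrACA. Qed.

(** [Z[t, t^-1]] is taken inside the field of fractions of [Z[t]], as the set of
    all [p / t ^+ n]. *)
Definition is_laurent : {pred K} := fun x =>
  `[< exists (p : {poly int}) (n : nat), x = p%:F / ('X : {poly int})%:F ^+ n >].

Fact X_frac_neq0 : ('X : {poly int})%:F != 0 :> K.
Proof. by rewrite tofrac_eq0 polyX_eq0. Qed.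

Lemma is_laurentP x : reflect
  (exists (p : {poly int}) (n : nat), x = p%:F / ('X : {poly int})%:F ^+ n)
  (x \in is_laurent).
Proof. exact: asboolP. Qed.

Fact laurent_subring : subring_closed is_laurent.
Proof.
have X0 n : ('X : {poly int})%:F ^+ n != 0 :> K by rewrite expf_neq0 ?X_frac_neq0.
split=> [|x y /is_laurentP[p [m ->]] /is_laurentP[q [n ->]]
         |x y /is_laurentP[p [m ->]] /is_laurentP[q [n ->]]].
- by apply/is_laurentP; exists 1, 0%N; rewrite expr0 divr1 tofrac1.
- apply/is_laurentP; exists (p * 'X^n - q * 'X^m), (m + n)%N.
  by rewrite tofracB !tofracM !tofracXn exprD sub_frac ?X0.
- apply/is_laurentP; exists (p * q), (m + n)%N.
  by rewrite tofracM exprD mul_frac.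
Qed.

HB.instance Definition _ := GRing.isSubringClosed.Build K is_laurent laurent_subring.

Record laurent := Laurent { laurent_val : K; _ : laurent_val \in is_laurent }.

HB.instance Definition _ := [isSub for laurent_val].
HB.instance Definition _ := [Choice of laurent by <:].
HB.instance Definition _ := [SubChoice_isSubComNzRing of laurent by <:].
HB.instance Definition _ := GRing.RMorphism.copy laurent_val (val : laurent -> K).

(** [x] is a unit of [Z[t, t^-1]] when its inverse in the field is again a
    Laurent polynomial; [invmx] and [unitmx] below refer to this structure. *)
Definition laurent_unit : {pred laurent} := fun x =>
  (val x != 0) && ((val x)^-1 \in is_laurent).
Definition laurent_inv (x : laurent) : laurent :=
  if x \in laurent_unit then insubd x (val x)^-1 else x.

Fact laurent_mulVr : {in laurent_unit, left_inverse 1 laurent_inv *%R}.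
Proof.
move=> x xU; apply: val_inj; rewrite /laurent_inv xU rmorphM /=.
by case/andP: xU => x0 xV; rewrite -[laurent_val _]/(val _) insubdK // mulVf.
Qed.

Fact laurent_unitP (x y : laurent) : y * x = 1 -> laurent_unit x.
Proof.
move=> /(congr1 val); rewrite rmorphM rmorph1 /= => yx1.
have x0 : val x != 0.
  by apply: contra_eq_neq yx1 => /= ->; rewrite mulr0 eq_sym oner_eq0.
have e : (val x)^-1 = val y by apply: (mulIf x0); rewrite mulVf.
by rewrite /laurent_unit x0 e; exact: valP.
Qed.

Fact laurent_inv_out : {in [predC laurent_unit], laurent_inv =1 id}.
Proof. by move=> x; rewrite inE /= /laurent_inv => /negbTE ->. Qed.

HB.instance Definition _ := GRing.ComNzRing_hasMulInverse.Build laurent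
  laurent_mulVr laurent_unitP laurent_inv_out.

Lemma laurent_unitE (x : laurent) :
  (x \is a GRing.unit) = (laurent_val x != 0) && ((laurent_val x)^-1 \in is_laurent).
Proof. by []. Qed.

Lemma laurent_valV (x : laurent) :
  x \is a GRing.unit -> laurent_val x^-1 = (laurent_val x)^-1.
Proof.
move=> xU; move: (xU); rewrite laurent_unitE => /andP[x0 _].
by apply: (mulfI x0); rewrite divff ?x0 // -rmorphM divrr ?rmorph1.
Qed.

Fact laurent_t_subproof : ('X : {poly int})%:F \in is_laurent.
Proof. by apply/is_laurentP; exists 'X, 0%N; rewrite expr0 divr1. Qed.

Definition laurent_t : laurent := Laurent laurent_t_subproof.

Fact laurent_t_unit : laurent_t \is a GRing.unit.
Proof.
apply/andP; split; first exact: X_frac_neq0.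
by apply/is_laurentP; exists 1, 1%N; rewrite tofrac1 expr1 div1r.
Qed.

End Laurent.

Section GL.
Local Open Scope ring_scope.
Variables (n : nat) (R : comUnitRingType).

Record GL := mkGL { GL_mx : 'M[R]_n; _ : GL_mx \in unitmx }.

HB.instance Definition _ := [isSub for GL_mx].
HB.instance Definition _ := [Choice of GL by <:].

Definition GL_one : GL := mkGL (unitmx1 R n).

Fact GL_mul_subproof (A B : GL) : GL_mx A *m GL_mx B \in unitmx.
Proof. by rewrite unitmx_mul (valP A) (valP B). Qed.

Definition GL_mul (A B : GL) : GL := mkGL (GL_mul_subproof A B).

Fact GL_inv_subproof (A : GL) : invmx (GL_mx A) \in unitmx.
Proof. by rewrite unitmx_inv (valP A). Qed.

Definition GL_inv (A : GL) : GL := mkGL (GL_inv_subproof A).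

Fact GL_mulA : associative GL_mul.
Proof. by move=> A B C; apply: val_inj; exact: mulmxA. Qed.

Fact GL_mul1g : left_id GL_one GL_mul.
Proof. by move=> A; apply: val_inj; exact: mul1mx. Qed.

Fact GL_mulg1 : right_id GL_one GL_mul.
Proof. by move=> A; apply: val_inj; exact: mulmx1. Qed.

Fact GL_mulVg : left_inverse GL_one GL_inv GL_mul.
Proof. by move=> A; apply: val_inj; exact: (mulVmx (valP A)). Qed.

Fact GL_mulgV : right_inverse GL_one GL_inv GL_mul.
Proof. by move=> A; apply: val_inj; exact: (mulmxV (valP A)). Qed.

HB.instance Definition _ := isGroup.Build GL
  GL_mulA GL_mul1g GL_mulg1 GL_mulVg GL_mulgV.

End GL.

Section BurauMatrices.
Local Open Scope ring_scope.
Variables (R : comUnitRingType) (t : R).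

Definition mx3 (rows : seq (seq R)) : 'M[R]_3 :=
  \matrix_(i < 3, j < 3) nth 0 (nth [::] rows i) j.

Definition burau_mx (i : 'I_3) : 'M[R]_3 :=
  match val i with
  | 0%N => mx3 [:: [:: - t;   1;   0];
                   [::   0;   1;   0];
                   [::   0;   0;   1]]
  | 1%N => mx3 [:: [::   1;   0;   0];
                   [::   t; - t;   1];
                   [::   0;   0;   1]]
  | _   => mx3 [:: [::   1;   0;   0];
                   [::   0;   1;   0];
                   [::   0;   t; - t]]
  end.

Definition burau_inv_mx (i : 'I_3) : 'M[R]_3 :=
  match val i with
  | 0%N => mx3 [:: [:: - t^-1; t^-1;      0];
                   [::      0;    1;      0];
                   [::      0;    0;      1]]
  | 1%N => mx3 [:: [::      1;    0;      0];
                   [::      1; - t^-1; t^-1];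
                   [::      0;    0;      1]]
  | _   => mx3 [:: [::      1;    0;      0];
                   [::      0;    1;      0];
                   [::      0;    1; - t^-1]]
  end.

Fact mx3E (rows : seq (seq R)) i j :
  mx3 rows i j = nth 0 (nth [::] rows i) j.
Proof. exact: mxE. Qed.

Fact mulmx3E (A B : 'M[R]_3) i j :
  (A *m B) i j = A i 0 * B 0 j + A i 1 * B 1 j + A i 2 * B 2 j.
Proof.
rewrite mxE !big_ord_recl big_ord0 addr0 addrA.
by congr (A i _ * B _ j + A i _ * B _ j + A i _ * B _ j); exact: val_inj.
Qed.

Fact burau_mulV (i : 'I_3) : t \is a GRing.unit -> burau_mx i *m burau_inv_mx i = 1%:M.
Proof.
move=> tU; have tV : t * t^-1 = 1 by rewrite divrr.
case: i => [[|[|[|//]]] ?]; apply/matrixP=> -[[|[|[|//]]] ?] [[|[|[|//]]] ?];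
  rewrite mulmx3E /burau_mx /burau_inv_mx /= !mx3E mxE /=; ring: tV.
Qed.

Fact burau_unitmx (i : 'I_3) : t \is a GRing.unit -> burau_mx i \in unitmx.
Proof. by move=> tU; have [] := mulmx1_unit (burau_mulV i tU). Qed.

Fact burau_adj (i j : 'I_3) : j = i.+1 :> nat ->
  burau_mx i *m burau_mx j *m burau_mx i = burau_mx j *m burau_mx i *m burau_mx j.
Proof.
case: i j => [[|[|[|//]]] ?] [[|[|[|//]]] ?] //= _;
  apply/matrixP=> -[[|[|[|//]]] ?] [[|[|[|//]]] ?];
  rewrite !mulmx3E /burau_mx /= !mx3E /=;
  rewrite ?(mul0r, mulr0, mul1r, mulr1, add0r, addr0); ring.
Qed.

Fact burau_far (i j : 'I_3) : (i.+1 < j)%N ->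
  burau_mx i *m burau_mx j = burau_mx j *m burau_mx i.
Proof.
case: i j => [[|[|[|//]]] ?] [[|[|[|//]]] ?] //= _;
  apply/matrixP=> -[[|[|[|//]]] ?] [[|[|[|//]]] ?];
  rewrite !mulmx3E /burau_mx /= !mx3E /=; ring.
Qed.

End BurauMatrices.

Section Burau.

Definition burau_gen (i : 'I_3) : GL 3 laurent :=
  mkGL (burau_unitmx i laurent_t_unit).

Fact burau_rel (u v : word 'I_3) :
  @braid_rel 4 u v -> eval_word burau_gen u = eval_word burau_gen v.
Proof.
case=> i j ij; rewrite /eval_word !big_cons !big_nil /eval_letter /= !mulg1 ?mulgA.
- by apply: val_inj; exact: burau_adj.
- by apply: val_inj; exact: burau_far.
Qed.

Definition beta4 : UMagmaMorphism.type (braid_group 4) (GL 3 laurent) :=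
  pres_lift burau_rel.

Lemma beta4_gen (i : 'I_3) : beta4 (pres_gen _ i) = burau_gen i.
Proof. exact: pres_liftE. Qed.

End Burau.

(* Main.v *)
Require Import Defs.
From HB Require Import structures.
From mathcomp Require Import all_boot all_order all_algebra.
From mathcomp Require Import boolp classical_sets.
From mathcomp Require Import fraction ring lra.
Local Open Scope classical_set_scope.
Local Open Scope group_scope.

Set Implicit Arguments.
Unset Strict Implicit.
Unset Printing Implicit Defensive.

Import Order.TTheory GRing.Theory Num.Theory.

(** The two matrices are played against each other in a ping-pong game after
    specialising [t] to a number.  A nontrivial
    relation over the Laurent polynomials would persist under every
    specialisation, so it is enough to exclude it at one value of [t].

    Write [A] for the image of [sigma3 * sigma1^-1].  Since [sigma1] and
    [sigma3] commute and each of their matrices has eigenvalues [-t, 1, 1], the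
    matrix [A] is diagonalisable with eigenvalues [-t], [1] and [-t^-1].  At
    [t = -2] these are [2], [1] and [1/2], and the eigenvectors have integral
    entries because [1 + t = -1] is a unit: they are [(0,0,1)], [(1,-1,-2)] and
    [(1,0,0)].  Hence [A ^+ m] pushes every vector with a non-negligible first
    eigencoordinate towards the first eigenline, and [A ^- m] pushes every
    vector with a non-negligible third one towards the third eigenline.

    The second matrix is the conjugate of [A ^+ m] by the image of [sigma2].
    The ping-pong works because [sigma2] and its inverse move both the first and
    the third eigenline off the two repelling planes of [A] (the planes on which
    the first or the third eigencoordinate vanishes).  As [t = -2] makes this
    quantitative with explicit constants ([sigma2_generic], [sigma2V_generic],
    [scale_attracting]), the bound [M = 8] comes out of [2 ^ 8 = 8 * 32], where
    [1/32] is the aperture of the attracting cones and [8] that of the cones of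
    non-negligible vectors.  [ping_pong] turns this into freeness. *)

(** * Reduced words and the ping-pong lemma *)

Section FreeGroups.
Context {S : choiceType}.

Definition inv_letter (l : S * bool) : S * bool := (l.1, ~~ l.2).

Definition reduced : word S -> bool := sorted (fun l l' => l' != inv_letter l).

(** Reading the word from the right, each new letter is either prepended to the
    reduced word found so far or cancels its first letter. *)
Lemma pres_eq_reduced (R : word S -> word S -> Prop) (w : word S) :
  exists2 v, reduced v & pres_eq R w v.
Proof.
elim: w => [|l w [v vred wv]]; first by exists [::] => //; exact: pres_refl.
have lwv : pres_eq R (l :: w) (l :: v).
  by apply: (@pres_cat _ _ [:: l] [:: l]) wv; exact: pres_refl.
case: v vred wv lwv => [|l' v] vred wv lwv; first by exists [:: l].
have [l'E|l'l] := eqVneq l' (inv_letter l); last first.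
  by exists [:: l, l' & v] => //=; apply/andP.
exists v; first exact: path_sorted vred.
apply: pres_trans lwv _; rewrite l'E; case: (l) => s b.
by apply: (@pres_cat _ _ [:: (s, b); (s, ~~ b)] [::] v v);
  [exact: pres_cancel | exact: pres_refl].
Qed.

Context {G : groupType} {f : S -> G}.

Lemma eval_word_cons l (w : word S) :
  eval_word f (l :: w) = eval_letter f l * eval_word f w.
Proof. by rewrite /eval_word big_cons. Qed.

Definition free_lift :
    UMagmaMorphism.type (presented (fun _ _ : word S => False)) G :=
  @pres_lift S (fun _ _ => False) G f (fun _ _ => False_ind _).

(** One set is played per letter rather than per generator: along a reduced word
    no letter follows its inverse, so induction on the word carries [x0] into
    the set of the first letter, and [x0] lies in none of them. *)
Lemma ping_pong (T : Type) (act : G -> T -> T) (X : S * bool -> set T) (x0 : T) :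
    (forall x, act 1 x = x) ->
    (forall g h x, act (g * h) x = act g (act h x)) ->
    (forall l, ~ X l x0) ->
    (forall l, X l (act (eval_letter f l) x0)) ->
    (forall l l' x, l' != inv_letter l -> X l' x ->
       X l (act (eval_letter f l) x)) ->
  injective free_lift.
Proof.
move=> act1 actM Xx0 Xl Xll'.
have Xred l w : reduced (l :: w) -> X l (act (eval_word f (l :: w)) x0).
  elim: w l => [|l' w IHw] l; rewrite eval_word_cons actM.
    by rewrite /eval_word big_nil act1.
  by move=> /= /andP[l'l wred]; apply: Xll' l'l _; apply: IHw.
suff ker1 x : free_lift x = 1 -> x = 1.
  move=> x y xy; apply: (mulIg y^-1); rewrite mulgV; apply: ker1.
  by rewrite gmulfM gmulfV xy mulgV.
have [v vred xv] := pres_eq_reduced (fun _ _ => False) (repr x).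
have -> : free_lift x = eval_word f v.
  exact: (eval_word_eq (fun _ _ => False_ind _) xv).
case: v vred xv => [|l w] wred xw lw1.
  by rewrite -[x]reprK; apply/pres_classP.
by have := Xred l w wred; rewrite lw1 act1 => /Xx0.
Qed.

Lemma range_lift : range free_lift = subgroup_gen (range f).
Proof.
apply/seteqP; split=> [_ [x _ <-] H [[H1 HV] fH]|].
  have {}HV : {in H &, forall u v, u * v^-1 \in H} by move=> u v; exact: HV.
  have VH g : g \in H -> g^-1 \in H.
    by move=> gH; rewrite -(mul1g g^-1); apply: HV.
  have lH l : eval_letter f l \in H.
    have fsH : f l.1 \in H by apply/mem_set/fH; exists l.1.
    by rewrite /eval_letter; case: ifP => // _; apply: VH.
  rewrite /= /pres_lift; apply: set_mem; elim: (repr x) => [|l w IHw].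
    by rewrite /eval_word big_nil.
  by rewrite eval_word_cons -[eval_word f w]invgK; apply: HV => //; apply: VH.
move=> g; apply; split.
  split; first by apply/mem_set; exists 1 => //; exact: gmulf1.
  move=> _ _ /set_mem[x _ <-] /set_mem[y _ <-]; apply/mem_set.
  by exists (x * y^-1) => //; rewrite gmulfM gmulfV.
by move=> _ [s _ <-]; exists (pres_gen _ s) => //; exact: pres_liftE.
Qed.

End FreeGroups.

(** * Evaluation of Laurent polynomials *)

Section Evaluation.
Local Open Scope ring_scope.
Context {F : comUnitRingType} {a : F}.

(** The value of [p / 'X^n] is [p.[a] / a ^+ n].  An element of the fraction
    field has many such presentations, so the value is chosen by its
    independence of the presentation, and every identity below is checked on
    presentations. *)
Lemma laurent_eval : a \is a GRing.unit ->
  exists phi : {rmorphism laurent -> F}, phi laurent_t = a.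
Proof.
move=> aU.
pose ev (p : {poly int}) : F := (map_poly intr p).[a].
have evM p q : ev (p * q) = ev p * ev q by rewrite /ev rmorphM hornerM.
have evB p q : ev (p - q) = ev p - ev q by rewrite /ev rmorphB hornerD hornerN.
have evX n : ev 'X^n = a ^+ n by rewrite /ev map_polyXn hornerXn.
have aXU n : a ^+ n \is a GRing.unit by rewrite unitrX.
pose X : {fraction {poly int}} := FracField.tofrac 'X.
have X0 n : X ^+ n != 0 by rewrite expf_neq0 ?X_frac_neq0.
have laurentE (x : laurent) :
    exists p n, laurent_val x = FracField.tofrac p / X ^+ n.
  by have /is_laurentP[p [n xE]] := valP x; exists p, n.
have /choice[phi phiP] (x : laurent) : exists y : F, forall p n,
    laurent_val x = FracField.tofrac p / X ^+ n -> y = ev p / a ^+ n.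
  have [p [n xE]] := laurentE x.
  exists (ev p / a ^+ n) => q k; rewrite xE => /eqP.
  rewrite (eqr_div _ _ (X0 n) (X0 k)) => /eqP pqF.
  have /eqP : FracField.tofrac (p * 'X^k) = FracField.tofrac (q * 'X^n).
    by rewrite !tofracM !tofracXn.
  rewrite tofrac_eq => /eqP/(congr1 ev).
  rewrite !evM !evX => pq; apply: (mulIr (aXU n)); apply: (mulIr (aXU k)).
  by rewrite divrK // pq mulrAC divrK // mulrC mulrAC.
have phiB : zmod_morphism phi.
  move=> x y; have [p [m xE]] := laurentE x.
  have [q [n yE]] := laurentE y.
  rewrite (phiP x _ _ xE) (phiP y _ _ yE).
  rewrite (phiP _ (p * 'X^n - q * 'X^m) (m + n)%N).
    rewrite evB !evM !evX exprD mulrBl; congr (_ - _).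
      by rewrite invrM // mulrA mulrK.
    by rewrite [a ^+ m * _]mulrC invrM // mulrA mulrK.
  by rewrite rmorphB /= xE yE tofracB !tofracM !tofracXn exprD sub_frac ?X0.
have phiM : monoid_morphism phi.
  split=> [|x y].
    by rewrite (phiP 1 1 0%N) ?expr0 ?divr1 ?tofrac1 // /ev rmorph1 hornerC.
  have [p [m xE]] := laurentE x.
  have [q [n yE]] := laurentE y.
  rewrite (phiP x _ _ xE) (phiP y _ _ yE).
  rewrite (phiP _ (p * q) (m + n)%N).
    by rewrite evM exprD invrM // [_^-1 * _^-1]mulrC mulrACA.
  by rewrite rmorphM /= xE yE tofracM exprD mul_frac.
pose phiA := GRing.isZmodMorphism.Build _ _ phi phiB.
pose phiMM := GRing.isMonoidMorphism.Build _ _ phi phiM.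
pose phiR : {rmorphism laurent -> F} := HB.pack phi phiA phiMM.
by exists phiR; rewrite /= (phiP _ 'X 0%N) ?expr0 ?divr1 // -['X]expr1 evX.
Qed.

End Evaluation.

(** * Cones around the eigenlines at t = -2 *)

Section Estimates.
Local Open Scope ring_scope.
Context {F : realFieldType}.

(** The vector with coordinates [p], [q], [r] in the basis [(0,0,1)], [(1,-1,-2)],
    [(1,0,0)] of eigenvectors of [sigma3 * sigma1^-1] for the eigenvalues [2],
    [1], [1/2]. *)
Definition eigcomb (p q r : F) : 'cV[F]_3 :=
  \col_i nth 0 [:: q + r; - q; p - 2 * q] i.

Lemma eigcomb_inj p q r p' q' r' :
  eigcomb p q r = eigcomb p' q' r' -> [/\ p = p', q = q' & r = r'].
Proof.
move=> /matrixP e; have := e 0 0; have := e 1 0; have := e 2 0.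
by rewrite !mxE /= => e2 e1 e0; split; lra.
Qed.

Definition dominates (k d q e : F) : Prop :=
  [/\ d != 0, `|q| <= k * `|d| & `|e| <= k * `|d|].

(** The Boolean is the sign of the power of [sigma3 * sigma1^-1] that expands
    the dominating coordinate, encoded as in the letters of words: [false] for
    positive powers and [true] for negative ones.  A small [k] gives a cone
    around an eigenline, a large [k] the complement of a neighbourhood of the
    plane on which the dominating coordinate vanishes. *)
Definition cone (k : F) (s : bool) : set 'cV[F]_3 :=
  [set u | exists p q r, u = eigcomb p q r /\
     if s then dominates k r q p else dominates k p q r].

Definition attracting : bool -> set 'cV[F]_3 := cone (1 / 32).

Definition generic : set 'cV[F]_3 := [set u | forall s, cone 8 s u].

Lemma coneE k s p q r :
  cone k s (eigcomb p q r) <-> if s then dominates k r q p else dominates k p q r.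
Proof.
by split=> [[p' [q' [r' [/eigcomb_inj[<- <- <-]]]]]|]; last exists p, q, r.
Qed.

Lemma sub_cone k k' s u : k <= k' -> cone k s u -> cone k' s u.
Proof.
move=> kk' [p [q [r [-> dom]]]]; apply/coneE.
by case: s dom => -[d0 qd ed]; split=> //;
  apply: le_trans (ler_wpM2r (normr_ge0 _) kk').
Qed.

(** In a generic vector the first and the third coordinate are within a factor
    [8] of each other, whereas in an attracting cone they differ by a factor of
    at least [32]. *)
Lemma generic_not_attracting s u : generic u -> ~ attracting s u.
Proof.
move=> gen [p [q [r [uE dom]]]]; move: (gen (~~ s)); rewrite uE => /coneE.
by case: s dom => -[d0 _ ed] [_ _ de]; move: d0; rewrite -normr_gt0; lra.
Qed.

(** The aperture drops from [8] to [1 / 32], a factor of [256], because the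
    dominating coordinate is multiplied by [x] and no other one grows. *)
Lemma scale_attracting (x : F) s p q r :
  256 <= x -> cone 8 s (eigcomb p q r) ->
  attracting s (if s then eigcomb (x^-1 * p) q (x * r)
                else eigcomb (x * p) q (x^-1 * r)).
Proof.
move=> x256 /coneE dom; have x0 : 0 < x by lra.
have xV1 : x^-1 <= 1 by rewrite invf_le1; lra.
have xV0 : 0 <= x^-1 by rewrite invr_ge0 ltW.
have scale d e : dominates 8 d q e -> dominates (1 / 32) (x * d) q (x^-1 * e).
  move=> [d0 qd ed]; rewrite /dominates !normrM (gtr0_norm x0) (ger0_norm xV0).
  have xd : 256 * `|d| <= x * `|d| by rewrite ler_wpM2r.
  have xe : x^-1 * `|e| <= `|e| by rewrite ler_piMl.
  by split; [rewrite mulf_neq0 // gt_eqF | lra | lra].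
by case: s dom => /scale dom; apply/coneE.
Qed.

Lemma le_norm2 (x : F) : x <= `|x| /\ - x <= `|x|.
Proof. by rewrite ler_norm -normrN ler_norm. Qed.

(* Only the sign of the dominating coordinate [d] is split upon: for the other
   absolute values the two linear lower bounds suffice, since the coordinates
   that have to be large are nonzero multiples of [d] up to a small error. *)
Ltac norm_bounds := repeat match goal with |- context [`|?x|] =>
  have [] := le_norm2 x; move: (`|x|) => ? end.

Ltac norm_lra d0 :=
  rewrite -?normr_gt0 ?ler_norml; try (apply/andP; split);
  move: d0; rewrite -normr_gt0; case: ger0P => d0; norm_bounds => *; lra.

(** The matrix of [sigma2] in the eigenbasis has no zero entry in its first and
    third columns: both eigenlines are sent off both repelling planes.  The
    aperture [1 / 32] is small enough for the two dominated coordinates not to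
    spoil the ratios of the entries of these columns, which stay below [8]. *)
Lemma sigma2_generic s p q r : attracting s (eigcomb p q r) ->
  generic (eigcomb (- p + 10 * q + 4 * r) (- p + 6 * q + 2 * r) (p - 5 * q - r)).
Proof.
move=> /coneE dom s'; apply/coneE; case: s dom => -[d0 qd ed];
  case: s'; split; move: qd ed; norm_lra d0.
Qed.

(** The same for the inverse matrix, whose first and third columns have no zero
    entry either. *)
Lemma sigma2V_generic s p q r : attracting s (eigcomb p q r) ->
  generic (eigcomb (2 * p - 5 * q - 2 * r) ((p - 3 * q - 2 * r) / 2)
                  ((- p + 5 * q + 4 * r) / 2)).
Proof.
move=> /coneE dom s'; apply/coneE; case: s dom => -[d0 qd ed];
  case: s'; split; move: qd ed; norm_lra d0.
Qed.

Lemma basepoint_generic : generic (eigcomb 1 0 (-1)).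
Proof.
by case; apply/coneE; split;
  rewrite ?oppr_eq0 ?oner_eq0 // ?normrN ?normr0 ?normr1; lra.
Qed.

Lemma sigma2V_basepoint_generic : generic (eigcomb 4 (3 / 2) (- (5 / 2))).
Proof.
have n4 : `|4 : F| = 4 by rewrite normr_nat.
have n3 : `|3 / 2 : F| = 3 / 2 by rewrite ger0_norm //; lra.
have n5 : `|- (5 / 2) : F| = 5 / 2 by rewrite normrN ger0_norm //; lra.
by case; apply/coneE; split; rewrite -?normr_gt0 ?n3 ?n4 ?n5; lra.
Qed.

End Estimates.

(** * The action of the Burau matrices *)

Section Action.
Local Open Scope ring_scope.
Context {F : realFieldType} {phi : {rmorphism laurent -> F}}.
Context (phi_t : phi laurent_t = -2).

Definition GL_act (g : GL 3 laurent) (u : 'cV[F]_3) : 'cV[F]_3 :=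
  map_mx phi (GL_mx g) *m u.

Lemma GL_act1 u : GL_act 1%g u = u.
Proof. by rewrite /GL_act map_mx1 mul1mx. Qed.

Lemma GL_actM g h u : GL_act (g * h)%g u = GL_act g (GL_act h u).
Proof. by rewrite /GL_act map_mxM mulmxA. Qed.

Lemma GL_actV g u v : GL_act g u = v -> GL_act g^-1%g v = u.
Proof. by move=> <-; rewrite -GL_actM mulVg GL_act1. Qed.

Lemma GL_act_burau i u : GL_act (burau_gen i) u = burau_mx (-2) i *m u.
Proof.
rewrite /GL_act -phi_t; congr (_ *m _).
case: i => [[|[|[|//]]] ?]; apply/matrixP=> -[[|[|[|//]]] ?] [[|[|[|//]]] ?];
  by rewrite /burau_mx /= !mxE /= ?rmorphN ?rmorph0 ?rmorph1.
Qed.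

Lemma act_sigma1 p q r :
  GL_act (beta4 sigma1) (eigcomb p q r) = eigcomb p q (2 * r).
Proof.
rewrite beta4_gen GL_act_burau; apply/matrixP=> -[[|[|[|//]]] ?] j.
all: rewrite mxE !big_ord_recl big_ord0 !mxE /=; ring.
Qed.

Lemma act_sigma3 p q r :
  GL_act (beta4 sigma3) (eigcomb p q r) = eigcomb (2 * p) q r.
Proof.
rewrite beta4_gen GL_act_burau; apply/matrixP=> -[[|[|[|//]]] ?] j.
all: rewrite mxE !big_ord_recl big_ord0 !mxE /=; ring.
Qed.

Lemma act_sigma2 p q r :
  GL_act (beta4 sigma2) (eigcomb p q r) =
  eigcomb (- p + 10 * q + 4 * r) (- p + 6 * q + 2 * r) (p - 5 * q - r).
Proof.
rewrite beta4_gen GL_act_burau; apply/matrixP=> -[[|[|[|//]]] ?] j.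
all: rewrite mxE !big_ord_recl big_ord0 !mxE /=; ring.
Qed.

Lemma act_sigma2V p q r :
  GL_act (beta4 sigma2)^-1%g (eigcomb p q r) =
  eigcomb (2 * p - 5 * q - 2 * r) ((p - 3 * q - 2 * r) / 2)
         ((- p + 5 * q + 4 * r) / 2).
Proof. by apply: GL_actV; rewrite act_sigma2; congr eigcomb; field. Qed.

Lemma act_sigma1V p q r :
  GL_act (beta4 sigma1)^-1%g (eigcomb p q r) = eigcomb p q (2^-1 * r).
Proof. by apply: GL_actV; rewrite act_sigma1; congr eigcomb; field. Qed.

Lemma act_sigma31 m p q r :
  GL_act (beta4 (sigma3 * sigma1^-1)%g ^+ m)%g (eigcomb p q r) =
  eigcomb (2 ^+ m * p) q ((2 ^+ m)^-1 * r).
Proof.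
elim: m p q r => [|m IHm] p q r; first by rewrite GL_act1 invr1 !mul1r.
rewrite expgSr GL_actM gmulfM gmulfV GL_actM act_sigma1V act_sigma3.
by rewrite -gmulfV -gmulfM IHm !mulrA -invfM -!exprSr.
Qed.

(** Writing the two generators as conjugates of one power of [A], by [1] and by
    the image of [sigma2], treats them uniformly: the attracting sets of the
    second one are the [sigma2]-translates of those of the first. *)
Definition conjugator (i : 'I_2) : GL 3 laurent :=
  if i == 0 then 1%g else beta4 sigma2.

Definition free_basis (m : nat) (i : 'I_2) : GL 3 laurent :=
  (conjugator i * beta4 (sigma3 * sigma1^-1) ^+ m * (conjugator i)^-1)%g.

Lemma eval_letter_free_basis m l :
  eval_letter (free_basis m) l =
  (conjugator l.1 * eval_letter (fun=> beta4 (sigma3 * sigma1^-1) ^+ m) l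
   * (conjugator l.1)^-1)%g.
Proof. by case: l => i []; rewrite /eval_letter //= !invgM invgK mulgA. Qed.

Lemma sigma31_attracts m (l : 'I_2 * bool) u : (8 <= m)%N -> cone 8 l.2 u ->
  attracting l.2
    (GL_act (eval_letter (fun=> beta4 (sigma3 * sigma1^-1)%g ^+ m)%g l) u).
Proof.
move=> m8 ucone; have [p [q [r [uE _]]]] := ucone; rewrite uE in ucone *.
have x256 : 256 <= 2 ^+ m :> F.
  have -> : 256 = 2 ^+ 8 :> F by ring.
  by rewrite ler_weXn2l // ler1n.
have x0 : 2 ^+ m != 0 :> F by rewrite expf_neq0 // pnatr_eq0.
have := scale_attracting x256 ucone; rewrite /eval_letter; case: l.2 => /=.
  suff -> : GL_act (beta4 (sigma3 * sigma1^-1) ^+ m)^-1%g (eigcomb p q r) =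
            eigcomb ((2 ^+ m)^-1 * p) q (2 ^+ m * r) by [].
  by apply: GL_actV; rewrite act_sigma31 mulVKf // mulKf.
by rewrite act_sigma31.
Qed.

Lemma conjugator_generic i j s u : i != j -> attracting s u ->
  generic (GL_act (conjugator i)^-1%g (GL_act (conjugator j) u)).
Proof.
move=> ij uattr; have [p [q [r [uE _]]]] := uattr; rewrite uE in uattr *.
case: i j ij => [[|[|//]] ?] [[|[|//]] ?] //= _; rewrite /conjugator /=.
  by rewrite invg1 GL_act1 act_sigma2; apply: sigma2_generic uattr.
by rewrite GL_act1 act_sigma2V; apply: sigma2V_generic uattr.
Qed.

Lemma conjugatorV_basepoint i :
  generic (GL_act (conjugator i)^-1%g (eigcomb 1 0 (-1))).
Proof.
rewrite /conjugator; case: eqP => _.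
  by rewrite invg1 GL_act1; apply: basepoint_generic.
rewrite act_sigma2V; set v := eigcomb _ _ _.
suff -> : v = eigcomb 4 (3 / 2) (- (5 / 2)) by apply: sigma2V_basepoint_generic.
by rewrite /v; congr eigcomb; field.
Qed.

(** The base point [eigcomb 1 0 (-1)] is one for which both it and its image
    under the inverse of [sigma2], which is [eigcomb 4 (3/2) (-5/2)], are
    generic; [eigcomb 1 0 1] would fail, its image having first coordinate
    [0]. *)
Lemma free_basis_injective m :
  (8 <= m)%N -> injective (free_lift (f := free_basis m)).
Proof.
move=> m8.
apply: (ping_pong (act := GL_act) (x0 := eigcomb 1 0 (-1))
  (X := fun l => GL_act (conjugator l.1) @` attracting l.2)).
- exact: GL_act1.
- exact: GL_actM.
- move=> l [v vattr /GL_actV vE].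
  apply: (generic_not_attracting _ vattr); rewrite -vE.
  exact: conjugatorV_basepoint.
- move=> l; rewrite eval_letter_free_basis !GL_actM.
  eexists; last reflexivity; apply: sigma31_attracts => //.
  exact: conjugatorV_basepoint.
- move=> l l' _ l'l [v vattr <-]; rewrite eval_letter_free_basis !GL_actM.
  eexists; last reflexivity; apply: sigma31_attracts => //.
  have [ll'|ll'] := eqVneq l.1 l'.1; last exact: (conjugator_generic ll' vattr).
  (* Two consecutive powers of the same generator have the same sign. *)
  rewrite ll' -GL_actM mulVg GL_act1.
  have -> : l.2 = l'.2.
    case: l l' l'l ll' {vattr} => i b [j b'] /= + ij.
    by rewrite ij xpair_eqE eqxx; case: b b' => -[].
  by apply: sub_cone vattr; lra.
Qed.

End Action.

(** * The theorem *)

Theorem theorem4p1 :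
  exists2 M : nat, (0 < M)%N &
    forall m : nat, (M <= m)%N ->
      free_of_rank 2
        (subgroup_gen
          [set beta4 (sigma3 * sigma1^-1) ^+ m;
               beta4 (sigma2 * sigma3 * sigma1^-1 * sigma2^-1) ^+ m]).
Proof.
exists 8%N => // m m8.
have [|phi phi_t] := @laurent_eval rat (-2)%R; first by rewrite unitfE.
exists (free_lift (f := free_basis m)); split.
  exact: (free_basis_injective phi_t m8).
rewrite range_lift; congr subgroup_gen.
have b0 : free_basis m ord0 = beta4 (sigma3 * sigma1^-1) ^+ m.
  by rewrite /free_basis /conjugator eqxx invg1 mul1g mulg1.
have b1 : free_basis m ord_max =
    beta4 (sigma2 * sigma3 * sigma1^-1 * sigma2^-1) ^+ m.
  rewrite /free_basis /conjugator /= -!gmulfXn -gmulfV -!gmulfM.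
  have -> : sigma2 * sigma3 * sigma1^-1 * sigma2^-1 =
            (sigma3 * sigma1^-1) ^ (sigma2^-1) by rewrite conjgE invgK !mulgA.
  by rewrite -conjXg conjgE invgK mulgA.
apply/seteqP; split=> [_ [i _ <-]|_ [|] ->]; last 2 first.
- by exists ord0.
- by exists ord_max.
case: (unliftP ord0 i) => [j|] ->; last by left.
by right; rewrite -b1; congr (free_basis m _); apply: val_inj; case: j => -[].
Qed.
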